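(* If $D$ and $C$ are oriented graphs such that $D$ is not $C$-colourable, then for every positive integer $\ell$ there exists an oriented graph $D^*$ of girth at least $\ell$ that is $D$-colourable but not $C$-colourable.
   Context: An oriented graph $D$ is a digraph with vertex set $V(D)$ and arc set $A(D)$ such that for every pair of vertices $u,v$ at most one of $uv$ and $vu$ is in $A(D)$; oriented graphs are always finite and loopless, without multiple arcs. Cycles are directed cycles, and the girth of an oriented graph is the length of a shortest directed cycle in it (with the convention that the girth is infinite if there is no directed cycle). For oriented graphs $D$ and $C$, a homomorphism from $D$ to $C$ is a map $f\colon V(D)\to V(C)$ such that $xy\in A(D)$ implies $f(x)f(y)\in A(C)$; such a homomorphism is also called a $C$-colouring of $D$, and $D$ is $C$-colourable if a $C$-colouring of $D$ exists. *)

(* Defs.v *)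
From mathcomp Require Import all_boot.

Set Implicit Arguments.
Unset Strict Implicit.
Unset Printing Implicit Defensive.

(* A vertex type is a finType, possibly empty; having the arc set given by a
   boolean relation excludes multiple arcs. *)
Record oriented_graph := OrientedGraph {
  vertex :> finType;
  arc : rel vertex;
  arc_loopless : forall u, ~~ arc u u;
  arc_oriented : forall u v, u != v -> ~~ (arc u v && arc v u)
}.

Definition is_homomorphism (D C : oriented_graph) (f : D -> C) : Prop :=
  forall x y : D, arc x y -> arc (f x) (f y).

Definition colourable (D C : oriented_graph) : Prop :=
  exists f : D -> C, is_homomorphism f.

(* The sequence of vertices of a directed cycle, without repetition of the
   starting vertex; the length of the cycle is the size of the sequence. *)
Definition dicycle (D : oriented_graph) (c : seq D) : bool :=
  (c != [::]) && ucycleb (@arc D) c.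

Definition has_dicycle (D : oriented_graph) (n : nat) : bool :=
  [exists c : n.-tuple D, dicycle c].

(* The least length of a dicycle, None standing for an infinite girth. Vertices
   of a dicycle are distinct, so no length exceeds #|D|. *)
Definition girth (D : oriented_graph) : option nat :=
  ohead [seq n <- iota 1 #|D| | has_dicycle D n].

Definition girth_at_least (l : nat) (D : oriented_graph) : bool :=
  if girth D is Some g then l <= g else true.

Lemma has_dicycleP (D : oriented_graph) (n : nat) :
  reflect (exists2 c : seq D, dicycle c & size c = n) (has_dicycle D n).
Proof.
apply: (iffP existsP) => [[c hc]|[c hc <-]].
  by exists c; rewrite ?size_tuple.
by exists (in_tuple c).
Qed.

Lemma dicycle_size (D : oriented_graph) (c : seq D) :
  dicycle c -> 0 < size c <= #|D|.
Proof.
case/and3P=> c0 _ /card_uniqP <-; rewrite max_card andbT.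
by case: c c0 => // x c _; apply/card_gt0P; exists x; exact: mem_head.
Qed.

Lemma girthP (D : oriented_graph) :
  match girth D with
  | Some g => (exists2 c : seq D, dicycle c & size c = g) /\
              (forall c : seq D, dicycle c -> g <= size c)
  | None => forall c : seq D, ~~ dicycle c
  end.
Proof.
have mem (c : seq D) : dicycle c -> size c \in [seq n <- iota 1 #|D| | has_dicycle D n].
  move=> hc; rewrite mem_filter mem_iota; apply/andP; split.
    by apply/has_dicycleP; exists c.
  exact: dicycle_size hc.
have srt : sorted leq [seq n <- iota 1 #|D| | has_dicycle D n].
  by apply: sorted_filter (iota_sorted _ _); exact: leq_trans.
have sub n : n \in [seq n <- iota 1 #|D| | has_dicycle D n] -> has_dicycle D n.
  by rewrite mem_filter => /andP[].
rewrite /girth; case: [seq _ <- _ | _] mem srt sub => [|g s] /= mem srt sub.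
  by move=> c; apply/negP => /mem.
split; first by apply/has_dicycleP/sub/mem_head.
move=> c /mem; rewrite inE => /predU1P[-> //|].
by move: srt => /(order_path_min leq_trans)/allP; apply.
Qed.

Lemma girth_at_leastP (D : oriented_graph) (l : nat) :
  reflect (forall c : seq D, dicycle c -> l <= size c) (girth_at_least l D).
Proof.
rewrite /girth_at_least; have := girthP D.
case: (girth D) => [g [gex gmin]|hnone]; last first.
  by apply: ReflectT => c hc; case/negP: (hnone c).
apply: (iffP idP) => [lg c /gmin|hl]; first exact: leq_trans.
by case: gex => c hc <-; exact: hl.
Qed.

(* Main.v *)
Require Import Defs.
From mathcomp Require Import all_boot.

(** Only directed cycles count towards the girth, so an acyclic graph has
    infinite girth, and the witness can be chosen acyclic: it is the product of D
    with a long transitive tournament.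

    The projection to D is a homomorphism, and arcs strictly increase the
    tournament coordinate (the level), which rules out directed cycles
    ([dicycle_layered]). A C-colouring of the product restricts on each level to
    a map from V(D) to V(C). When there are more levels than such maps, two
    levels i < j carry the same map g; every arc uv of D lifts to an arc from u
    at level i to v at level j, so g(u)g(v) is an arc of C. Hence g is a
    C-colouring of D ([colourable_of_layered]). *)

Definition layered_arc (D : oriented_graph) (n : nat) : rel (D * 'I_n) :=
  fun p q => Defs.arc p.1 q.1 && (p.2 < q.2).

Lemma layered_arc_loopless (D : oriented_graph) (n : nat) (p : D * 'I_n) :
  ~~ layered_arc D n p p.
Proof. by rewrite /layered_arc ltnn andbF. Qed.

Lemma layered_arc_oriented (D : oriented_graph) (n : nat) (p q : D * 'I_n) :
  p != q -> ~~ (layered_arc D n p q && layered_arc D n q p).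
Proof.
move=> _; apply/negP => /andP[/andP[_ pq] /andP[_ qp]].
by have := ltn_trans pq qp; rewrite ltnn.
Qed.

Definition layered (D : oriented_graph) (n : nat) : oriented_graph :=
  OrientedGraph (layered_arc_loopless D n) (layered_arc_oriented D n).

Lemma layered_colourable (D : oriented_graph) (n : nat) :
  colourable (layered D n) D.
Proof. by exists fst => p q /andP[]. Qed.

(** The level strictly increases along arcs, so going once around a directed
    cycle would put the level of its first vertex below itself. *)
Lemma dicycle_layered (D : oriented_graph) (n : nat) (c : seq (layered D n)) :
  ~~ dicycle c.
Proof.
case: c => // x c; apply/negP => /and3P[_ cyc _].
pose below (p q : layered D n) := p.2 < q.2.
have below_trans : transitive below by move=> q p r; apply: ltn_trans.
have : path below x (rcons c x).
  by apply: sub_path cyc => p q /andP[].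
move/(order_path_min below_trans)/allP/(_ x).
by rewrite mem_rcons mem_head /below ltnn => /(_ isT).
Qed.

(** Pigeonhole: two levels carry the same map from V(D) to V(C), and since all
    arcs of D are present from the lower of these levels to the higher one, this
    common map is a homomorphism. *)
Lemma colourable_of_layered (D C : oriented_graph) (n : nat) :
  #|{ffun D -> C}| < n -> colourable (layered D n) C -> colourable D C.
Proof.
move=> many_levels [f hom_f].
pose g (i : 'I_n) : {ffun D -> C} := [ffun u => f (u, i)].
have /injectivePn[i [j ne_ij eq_g]] : ~~ injectiveb g.
  apply/negP => /injectiveP/leq_card.
  by rewrite card_ord leqNgt many_levels.
wlog lt_ij : i j ne_ij eq_g / i < j.
  move=> WH; case: (ltngtP i j) => [|gt_ij|/val_inj eq_ij]; first exact: WH.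
    by apply: (WH j i); rewrite // eq_sym.
  by rewrite eq_ij eqxx in ne_ij.
exists (g i) => u v uv; rewrite {2}eq_g !ffunE.
by apply: hom_f; rewrite /= /layered_arc /= uv.
Qed.

Theorem corollary1p2 (D C : oriented_graph) (hDC : ~ colourable D C) (l : nat) (hl : 0 < l) :
  exists Dstar : oriented_graph,
    [/\ girth_at_least l Dstar, colourable Dstar D & ~ colourable Dstar C].
Proof.
exists (layered D #|{ffun D -> C}|.+1); split.
- by apply/girth_at_leastP => c hc; case/negP: (dicycle_layered _ _ c).
- exact: layered_colourable.
- by move/(colourable_of_layered _ _ _ (ltnSn _)).
Qed.
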